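(* Let $n\ge 1$ be an integer. If $f \colon S^n \to \mathbb{R}^{n+2}$ is odd and continuous, then there is a subset $X \subseteq S^n$ of diameter at most $r_n$ such that $\mathrm{conv}(f(X))$ contains the origin.
   Context: The sphere $S^n$ carries the standard spherical geodesic metric in which every great circle has length $2\pi$, and $\mathrm{diam}(X)=\sup\{d(x,y) : x,y\in X\}$ is taken with respect to it. $r_n$ denotes the diameter, in this metric, of the vertex set of a regular $(n+1)$-simplex inscribed in $S^n$. A map $f\colon S^n\to\mathbb{R}^m$ is odd if $f(-x)=-f(x)$ for all $x\in S^n$. $\mathrm{conv}(Y)$ denotes the convex hull of $Y$. *)

(* Defs.v *)
From HB Require Import structures.
From mathcomp Require Import all_boot all_order all_algebra.
From mathcomp Require Import all_classical all_reals all_analysis.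
From mathcomp Require Import ring lra.
Set Implicit Arguments.
Unset Strict Implicit.
Unset Printing Implicit Defensive.
Import Order.TTheory GRing.Theory Num.Theory.
Import numFieldNormedType.Exports.
Local Open Scope classical_set_scope.
Local Open Scope ring_scope.

Definition dot (R : realType) (m : nat) (u v : 'rV[R]_m) : R :=
  \sum_(i < m) u 0 i * v 0 i.

(* The library norm on ['rV[R]_m] is the sup norm: it induces the same topology,
   but is not the Euclidean length. *)
Definition enorm (R : realType) (m : nat) (u : 'rV[R]_m) : R :=
  Num.sqrt (dot u u).

Definition sphere (R : realType) (n : nat) : set 'rV[R]_n.+1 :=
  [set x | enorm x = 1].
Arguments sphere : clear implicits.

(* Meaningful for unit vectors only: the angle between [x] and [y]. *)
Definition geod (R : realType) (m : nat) (x y : 'rV[R]_m) : R := acos (dot x y).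

(* For [X] inside the sphere the set of distances is bounded by [pi], so this is
   a genuine supremum as soon as [X] is nonempty; [diam set0 = 0]. *)
Definition diam (R : realType) (m : nat) (X : set 'rV[R]_m) : R :=
  sup [set geod p.1 p.2 | p in X `*` X].

Definition conv_hull (R : realType) (m : nat) (Y : set 'rV[R]_m) :
    set 'rV[R]_m :=
  smallest (@convex_set R 'rV[R]_m) Y.

Definition affinely_independent (R : realType) (m k : nat)
    (v : 'I_k -> 'rV[R]_m) : Prop :=
  forall c : 'I_k -> R,
    \sum_(i < k) c i = 0 -> \sum_(i < k) c i *: v i = 0 -> forall i, c i = 0.

(* The family of vertices of a regular (k-1)-simplex: the simplex is
   nondegenerate and all its edges have the same Euclidean length. *)
Definition regular_simplex (R : realType) (m k : nat)
    (v : 'I_k -> 'rV[R]_m) : Prop :=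
  affinely_independent v /\
  forall i j i' j', i != j -> i' != j' ->
    enorm (v i - v j) = enorm (v i' - v j').

Definition inscribed_regular_simplex (R : realType) (n : nat)
    (v : 'I_n.+2 -> 'rV[R]_n.+1) : Prop :=
  regular_simplex v /\ (forall i, sphere R n (v i)).

(* [rn R n] is the common value of [diam (range v)] over all regular
   (n+1)-simplices inscribed in the n-sphere; see [ex_inscribed_regular_simplex]
   and [diam_inscribed_regular_simplex] below. *)
Definition rn (R : realType) (n : nat) : R :=
  get [set d | exists2 v : 'I_n.+2 -> 'rV[R]_n.+1,
                 inscribed_regular_simplex v & d = diam (range v)].
Arguments rn : clear implicits.

Lemma dotC (R : realType) m (u v : 'rV[R]_m) : dot u v = dot v u.
Proof. by apply: eq_bigr => i _; rewrite mulrC. Qed.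

Lemma dotDl (R : realType) m (u v w : 'rV[R]_m) : dot (u + v) w = dot u w + dot v w.
Proof. by rewrite -big_split; apply: eq_bigr => i _; rewrite mxE mulrDl. Qed.

Lemma dotZl (R : realType) m a (u w : 'rV[R]_m) : dot (a *: u) w = a * dot u w.
Proof. by rewrite mulr_sumr; apply: eq_bigr => i _; rewrite mxE mulrA. Qed.

Lemma dotDr (R : realType) m (u v w : 'rV[R]_m) : dot w (u + v) = dot w u + dot w v.
Proof. by rewrite dotC dotDl !(dotC w). Qed.

Lemma dotZr (R : realType) m a (u w : 'rV[R]_m) : dot w (a *: u) = a * dot w u.
Proof. by rewrite dotC dotZl (dotC w). Qed.

Lemma dotNl (R : realType) m (u w : 'rV[R]_m) : dot (- u) w = - dot u w.
Proof. by rewrite -scaleN1r dotZl mulN1r. Qed.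

Lemma dotNr (R : realType) m (u w : 'rV[R]_m) : dot w (- u) = - dot w u.
Proof. by rewrite dotC dotNl (dotC w). Qed.

Lemma dot_sumr (R : realType) m k (F : 'I_k -> 'rV[R]_m) w :
  dot w (\sum_i F i) = \sum_i dot w (F i).
Proof.
rewrite /dot exchange_big /=; apply: eq_bigr => i _.
by rewrite summxE mulr_sumr.
Qed.

Lemma dot_ge0 (R : realType) m (u : 'rV[R]_m) : 0 <= dot u u.
Proof. by apply: sumr_ge0 => i _; rewrite -expr2 sqr_ge0. Qed.

Lemma sphereE (R : realType) n (x : 'rV[R]_n.+1) : sphere R n x <-> dot x x = 1.
Proof.
rewrite /sphere /= /enorm; split=> [h|->]; last exact: sqrtr1.
by rewrite -(sqr_sqrtr (dot_ge0 x)) h expr1n.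
Qed.

Lemma dot_subE (R : realType) m (u v : 'rV[R]_m) :
  dot (u - v) (u - v) = dot u u + dot v v - 2 * dot u v.
Proof. by rewrite dotDl !dotDr !dotNl !dotNr (dotC v u); ring. Qed.

Lemma simplex_dot (R : realType) n (v : 'I_n.+2 -> 'rV[R]_n.+1) :
  inscribed_regular_simplex v ->
  forall i j, i != j -> dot (v i) (v j) = - (n.+1%:R)^-1.
Proof.
move=> [[aff edge] sph].
have n0 : n.+1%:R != 0 :> R by rewrite pnatr_eq0.
have v1 i : dot (v i) (v i) = 1 by exact/sphereE.
pose o0 : 'I_n.+2 := ord0; pose o1 : 'I_n.+2 := lift ord0 ord0.
pose c := dot (v o0) (v o1).
have vc i j : i != j -> dot (v i) (v j) = c.
  move=> ij; have := edge i j o0 o1 ij isT; rewrite /enorm => /(congr1 (@GRing.exp R ^~ 2)).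
  by rewrite !sqr_sqrtr ?dot_ge0// !dot_subE !v1 -/c; lra.
have dv j (l : 'I_n.+2 -> R) :
    dot (v j) (\sum_i l i *: v i) = (1 - c) * l j + c * \sum_i l i.
  rewrite dot_sumr (bigD1 j)//= dotZr v1 [in RHS](bigD1 j)//=.
  rewrite (eq_bigr (fun i => c * l i)); last first.
    by move=> i ij; rewrite dotZr vc 1?eq_sym// mulrC.
  by rewrite -mulr_sumr; ring.
pose A : 'M[R]_(n.+2, n.+1) := \matrix_i v i.
have [u u0 uA] : exists2 u : 'rV[R]_n.+2, u != 0 & u *m A = 0.
  have : ~~ row_free A.
    by rewrite /row_free neq_ltn (leq_ltn_trans (rank_leq_col A)).
  rewrite -kermx_eq0 => /rowV0Pn[u /sub_kermxP uA u0]; by exists u.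
have uv : \sum_i u 0 i *: v i = 0.
  by rewrite -[RHS]uA mulmx_sum_row; apply: eq_bigr => i _; rewrite rowK.
pose s := \sum_i u 0 i.
have us j : (1 - c) * u 0 j + c * s = 0.
  by rewrite -(dv j (u 0)) uv -(scale0r 0) dotZr mul0r.
have s0 : s != 0.
  apply: contra_neq u0 => s0; apply/rowP => i; rewrite mxE.
  exact: (aff (u 0) s0 uv).
have : ((1 - c) + n.+2%:R * c) * s = \sum_j ((1 - c) * u 0 j + c * s).
  rewrite big_split/= -mulr_sumr -/s sumr_const card_ord -[(c * s) *+ _]mulr_natl.
  by rewrite mulrDl mulrA.
rewrite big1//.
move/eqP; rewrite mulf_eq0 (negPf s0) orbF => /eqP h i j /vc ->.
apply: (mulfI n0); rewrite mulrN mulfV//.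
by move: h; rewrite -[n.+2%:R]natr1 mulrDl mul1r; lra.
Qed.

Lemma diam_inscribed_regular_simplex (R : realType) n (v : 'I_n.+2 -> 'rV[R]_n.+1) :
  inscribed_regular_simplex v -> diam (range v) = acos (- (n.+1%:R)^-1).
Proof.
move=> hv; have vd := simplex_dot hv; have [_ sph] := hv.
have v1 i : dot (v i) (v i) = 1 by exact/sphereE.
have i0 : 0 <= (n.+1%:R : R)^-1 <= 1 by rewrite invr_ge0 ler0n invf_le1// ler1n.
set a := acos _.
have a0 : 0 <= a.
  apply: acos_ge0; case/andP: i0; move: (_^-1) => x x0 x1.
  by rewrite lerN2 x1 lerNl (le_trans _ x0)// oppr_le0.
have mem : [set geod p.1 p.2 | p in range v `*` range v] a.
  exists (v ord0, v (lift ord0 ord0)); first by split; eexists.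
  by rewrite /geod /= vd.
have ub : ubound [set geod p.1 p.2 | p in range v `*` range v] a.
  move=> _ [[_ _] [[i _ <-] [j _ <-]] <-]; rewrite /geod /=.
  by have [->|/vd ->//] := eqVneq i j; rewrite v1 acos1.
apply/eqP; rewrite eq_le; apply/andP; split.
  by apply: ge_sup => //; exists a.
by apply: ub_le_sup => //; exists a.
Qed.

Lemma ex_inscribed_regular_simplex (R : realType) n :
  exists v : 'I_n.+2 -> 'rV[R]_n.+1, inscribed_regular_simplex v.
Proof.
pose d : R := n.+1%:R.
have d0 : 0 < d by rewrite ltr0n.
pose q := Num.sqrt d^-1; pose a := Num.sqrt (1 + d^-1); pose b := (q - a) / d.
have q2 : q * q = d^-1 by rewrite -expr2 sqr_sqrtr// invr_ge0 ltW.
have a2 : a * a = 1 + d^-1.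
  by rewrite -expr2 sqr_sqrtr// addr_ge0// invr_ge0 ltW.
have d1 : 0 < 1 + d^-1 by rewrite addr_gt0// invr_gt0.
pose one : 'rV[R]_n.+1 := const_mx 1.
pose e (i : 'I_n.+1) : 'rV[R]_n.+1 := delta_mx 0 i.
have d11 : dot one one = d.
  rewrite /dot (eq_bigr (fun=> 1)) => [|i _]; last by rewrite !mxE mulr1.
  by rewrite sumr_const card_ord.
have dle i w : dot (e i) w = w 0 i.
  rewrite /dot (bigD1 i)//= big1 => [|j ji]; rewrite !mxE !eqxx ?eqxx//=.
    by rewrite mul1r addr0.
  by rewrite (negPf ji) mul0r.
have db : d * b = q - a by rewrite /b mulrC divfK ?gt_eqF.
have dV : d * d^-1 = 1 by rewrite mulfV ?gt_eqF.
pose v (i : 'I_n.+2) : 'rV[R]_n.+1 :=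
  if unlift ord0 i is Some j then a *: e j + b *: one else (- q) *: one.
have v0 : v ord0 = - q *: one by rewrite /v unlift_none.
have vS j : v (lift ord0 j) = a *: e j + b *: one by rewrite /v liftK.
have key : 2 * (a * b) + b * b * d = - d^-1.
  have -> : 2 * (a * b) + b * b * d = b * (2 * a + d * b) by ring.
  rewrite db /b -mulrA [_^-1 * _]mulrC mulrA.
  have -> : (q - a) * (2 * a + (q - a)) = q * q - a * a by ring.
  by rewrite q2 a2 opprD addrCA subrr addr0 mulN1r.
have vv i j : dot (v i) (v j) = if i == j then 1 else - d^-1.
  have H k : dot (v ord0) (v (lift ord0 k)) = - d^-1.
    rewrite v0 vS dotZl dotDr !dotZr (dotC one) dle mxE d11.
    by rewrite mulr1 mulrDr [b * d]mulrC db -mulrDr addrC subrK mulNr q2.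
  case: (unliftP ord0 i) => [i'|] ->; case: (unliftP ord0 j) => [j'|] ->.
  - rewrite !vS (inj_eq lift_inj) dotDl !dotDr !dotZl !dotZr d11.
    rewrite (dotC one) !dle !mxE eqxx /= !mulr1.
    have -> : a * (a * (i' == j')%:R) + a * b + (b * a + b * (b * d))
              = a * a * (i' == j')%:R + (2 * (a * b) + b * b * d) by ring.
    rewrite key a2; case: eqVneq => _; last by rewrite mulr0 add0r.
    by rewrite mulr1 addrK.
  - by rewrite dotC H eq_sym (negPf (neq_lift _ _)).
  - by rewrite H (negPf (neq_lift _ _)).
  - by rewrite eqxx v0 dotZl dotZr d11 mulrA mulrNN q2 mulrC.
exists v; split; last by move=> i; apply/sphereE; rewrite vv eqxx.
split; last by move=> i j i' j' /negPf ij /negPf ij'; rewrite /enorm !dot_subE !vv !eqxx ij ij'.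
move=> c c0 cv.
have ci i : c i * (1 + d^-1) = 0.
  have : dot (v i) (\sum_j c j *: v j) = 0.
    by rewrite cv -(scale0r 0) dotZr mul0r.
  rewrite dot_sumr (bigD1 i)//= dotZr vv eqxx mulr1.
  rewrite (eq_bigr (fun j => c j * - d^-1)); last first.
    by move=> j ji; rewrite dotZr vv eq_sym (negPf ji).
  rewrite -mulr_suml; move: c0; rewrite (bigD1 i)//= => /eqP.
  by rewrite addrC addr_eq0 => /eqP ->; rewrite mulrNN mulrDr mulr1.
move=> i; apply/eqP; have /eqP := ci i; rewrite mulf_eq0 => /orP[//|].
by rewrite gt_eqF.
Qed.

Lemma rnE (R : realType) n : rn R n = acos (- (n.+1%:R)^-1).
Proof.
have [v hv] := ex_inscribed_regular_simplex R n.
rewrite /rn; case: xgetP => [d -> [w hw ->]|].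
  exact: diam_inscribed_regular_simplex.
by move=> /(_ (diam (range v)))[]; exists v.
Qed.

(* Main.v *)
(* By the Borsuk-Ulam theorem it suffices to write down an odd continuous map
   from [R^2 x R^(n+1)] minus the origin to [R^(n+2)], each value of which is a
   positive combination of values of [f] on a set of diameter at most [r_n]
   (this stands for an odd map from the join [S^1 * S^n = S^(n+2)]).
   Move a regular simplex [v] along a circle of rotations [y |-> v(y)] such that
   [v(-y) = - v(y)] as a set of vertices, and map [(y, x)] to a combination of
   [f (x / |x|)], present when [|x| > |y|], and of the [f (v_i(y))] with
   [x . v_i(y) > - |y| / (n + 1)], present when [|y| > |x| / 2].  When [x / |x|]
   and [v_i(y)] both occur, their inner product exceeds [- 1 / (n + 1)], the
   cosine of [r_n]; two vertices of the simplex are at distance exactly [r_n].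
   Borsuk-Ulam itself follows from Ky Fan's combinatorial lemma on iterated
   barycentric subdivisions of the octahedral sphere, over [F_2]: a labelling of
   the vertices by the largest coordinate and its sign has an edge with opposite
   labels, which continuity and compactness exclude if there is no zero. *)
Require Import Defs.
From HB Require Import structures.
From mathcomp Require Import all_boot all_order all_algebra.
From mathcomp Require Import all_classical all_reals all_analysis.
From mathcomp Require Import perm ring lra zify.
Import Order.TTheory GRing.Theory Num.Theory.
Import numFieldNormedType.Exports.
Set Implicit Arguments.
Unset Strict Implicit.
Unset Printing Implicit Defensive.
Local Open Scope classical_set_scope.
Local Open Scope ring_scope.

(** * Mod 2 cochains and Ky Fan's counting lemma *)

(** The boundary is augmented: a single vertex has the empty simplex as its face. This makes
    dimension 0 the base case of the parity count. *)
Fixpoint bd (T : Type) (s : seq T) : seq (seq T) :=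
  if s is x :: s' then s' :: map (cons x) (bd s') else [::].

(* Chains over [F_2] are lists of simplices, read through the values that
   cochains [phi : seq T -> bool] take on them. *)
Definition pairing (T : Type) (phi : T -> bool) (c : seq T) : bool :=
  \big[addb/false]_(s <- c) phi s.

Definition cobd (T : Type) (phi : seq T -> bool) (s : seq T) : bool :=
  pairing phi (bd s).

Lemma pairing_nil (U : Type) (phi : U -> bool) : pairing phi [::] = false.
Proof. exact: big_nil. Qed.

Lemma pairing_cons (U : Type) (phi : U -> bool) x c :
  pairing phi (x :: c) = phi x (+) pairing phi c.
Proof. exact: big_cons. Qed.

Lemma pairing_cat (U : Type) (phi : U -> bool) c1 c2 :
  pairing phi (c1 ++ c2) = pairing phi c1 (+) pairing phi c2.
Proof. exact: big_cat. Qed.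

Lemma pairing_map (U U' : Type) (phi : U -> bool) (h : U' -> U) c :
  pairing phi (map h c) = pairing (phi \o h) c.
Proof. exact: big_map. Qed.

Lemma pairing_flatten (U : Type) (phi : U -> bool) (C : seq (seq U)) :
  pairing phi (flatten C) = pairing (pairing phi) C.
Proof. exact: big_flatten. Qed.

Lemma pairing_add (U : Type) (phi psi : U -> bool) c :
  pairing (fun s => phi s (+) psi s) c = pairing phi c (+) pairing psi c.
Proof. exact: big_split. Qed.

Lemma eq_pairing (U : Type) (phi psi : U -> bool) :
  phi =1 psi -> pairing phi =1 pairing psi.
Proof. by move=> e c; apply: eq_bigr => s _; apply: e. Qed.

Lemma eq_in_pairing (U : eqType) (phi psi : U -> bool) c :
  {in c, phi =1 psi} -> pairing phi c = pairing psi c.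
Proof. by move=> e; rewrite /pairing big_seq [RHS]big_seq; apply: eq_bigr => s /e. Qed.

Lemma cobd_cons (T : Type) (phi : seq T -> bool) x s :
  cobd phi (x :: s) = phi s (+) cobd (phi \o cons x) s.
Proof. by rewrite /cobd /= pairing_cons pairing_map. Qed.

(** By the cone formula [cobd_cons], the term [cobd phi s] occurs twice and cancels. *)
Lemma cobd_cobd (T : Type) (phi : seq T -> bool) s : cobd (cobd phi) s = false.
Proof.
elim: s phi => [|x s IH] phi; first by rewrite /cobd pairing_nil.
rewrite cobd_cons (_ : cobd (_ \o _) s = cobd phi s (+) cobd (cobd (phi \o cons x)) s).
  by rewrite IH addbF addbb.
by rewrite -pairing_add; apply: eq_pairing => t; rewrite /= cobd_cons.
Qed.

Lemma size_bd (T : Type) (s : seq T) : all (fun t => size t == (size s).-1) (bd s).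
Proof.
elim: s => //= x s IH; rewrite eqxx /= all_map.
case: s IH => // y s IH; apply: sub_all IH => t /= /eqP ->; exact: eqxx.
Qed.

Lemma bd_map (T U : Type) (h : T -> U) s : bd (map h s) = map (map h) (bd s).
Proof. by elim: s => //= x s ->; rewrite -!map_comp. Qed.

Lemma bd_subseq (T : eqType) (s t : seq T) : t \in bd s -> subseq t s.
Proof.
elim: s t => //= x s IH t; rewrite in_cons => /orP[/eqP ->|].
  exact: subseq_cons.
by move=> /mapP[u us ->]; rewrite /= eqxx IH.
Qed.

(** With repeated vertices [rem] gives the right face only up to order; the symmetry of [phi]
    absorbs this. *)
Lemma cobd_rem (T : eqType) (phi : seq T -> bool) (s : seq T) :
  (forall t t', perm_eq t t' -> phi t = phi t') ->
  cobd phi s = pairing (fun x => phi (rem x s)) s.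
Proof.
elim: s phi => [|x s IH] phi hphi; first by rewrite /cobd !pairing_nil.
rewrite cobd_cons pairing_cons /= eqxx; congr (_ (+) _).
rewrite IH => [|t t' tt']; last by apply: hphi; rewrite perm_cons.
apply: eq_in_pairing => y ys; rewrite /comp /=; have [xy|//] := eqVneq x y.
by apply: hphi; rewrite xy perm_sym perm_to_rem.
Qed.

Lemma perm_cobd (T : eqType) (phi : seq T -> bool) (s s' : seq T) :
  (forall t t', perm_eq t t' -> phi t = phi t') ->
  perm_eq s s' -> cobd phi s = cobd phi s'.
Proof.
move=> hphi ss'; rewrite !cobd_rem//.
transitivity (pairing (fun x => phi (rem x s')) s); last exact: perm_big.
apply: eq_in_pairing => x xs; apply: hphi.
rewrite -(perm_cons x) -(permPl (perm_to_rem xs)) (permPl ss').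
by apply: perm_to_rem; rewrite -(perm_mem ss').
Qed.

(** * Alternating signs and labels *)

Fixpoint alternating (b : bool) (s : seq bool) : bool :=
  if s is x :: s' then (x == b) && alternating (~~ b) s' else true.

Lemma alternating_negb b s :
  alternating b (map negb s) = alternating (~~ b) s.
Proof. by elim: s b => //= x s IH b; rewrite IH; case: x; case: b. Qed.

(** If the first sign is [~~ b], only the face omitting it can alternate from [b]. If it is [b], the
    face omitting it cancels one of the two terms given by induction. *)
Lemma cobd_alternating b s :
  cobd (alternating b) s = alternating b s (+) alternating (~~ b) s.
Proof.
elim: s b => [|x s IH] b; first by rewrite /cobd pairing_nil.
rewrite cobd_cons /=; have [->|xb] := eqVneq x b.
  rewrite (_ : cobd (_ \o _) s = cobd (alternating (~~ b)) s).
    by rewrite IH negbK -[_ && _]/(alternating _ _); case: b => /=;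
      rewrite addbF addbCA addbb addbF.
  by apply: eq_pairing => t /=; rewrite eqxx.
have -> : x = ~~ b by case: x b xb => -[].
rewrite eqxx negbK /= (_ : cobd (_ \o _) s = false) ?addbF//.
apply: big1_idem => // t _ /=; by case: b {IH xb}.
Qed.

(* A vertex labelled [l] carries the index [l./2] and the sign [odd l]. *)
Definition label_opp (l : nat) : nat := if odd l then l.-1 else l.+1.

(** In the language of Tucker's and Fan's lemmas: no complementary edge. *)
Definition compatible (s : seq nat) : Prop :=
  {in s &, forall l m, l./2 = m./2 -> l = m}.

Lemma odd_label_opp l : odd (label_opp l) = ~~ odd l.
Proof. by rewrite /label_opp; case: ifP => ol; lia. Qed.

Lemma half_label_opp l : (label_opp l)./2 = l./2.
Proof. rewrite /label_opp; case: ifP => ol; lia. Qed.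

(** [label_opp] exchanges [2i] and [2i + 1], so it keeps the order of labels with different indices;
    compatible labels with the same index are equal. *)
Lemma map_sort_label_opp s : compatible s ->
  sort leq (map label_opp s) = map label_opp (sort leq s).
Proof.
move=> cs; apply: (sorted_eq leq_trans anti_leq); first exact/sort_sorted/leq_total.
  have hs : all (mem s) (sort leq s) by apply/allP => l; rewrite mem_sort.
  apply: (homo_sorted_in _ hs (sort_sorted leq_total s)) => l m ls ms lm.
  have [/(cs _ _ ls ms) <-|lm2] := eqVneq l./2 m./2; first exact: leqnn.
  have lt2 : (l./2 < m./2)%N by rewrite ltn_neqAle lm2 half_leq.
  rewrite -[label_opp l]odd_double_half -[label_opp m]odd_double_half.
  rewrite !half_label_opp; apply: (@leq_trans (m./2).*2); last exact: leq_addl.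
  apply: (@leq_trans (l./2).+1.*2); last by rewrite leq_double.
  by rewrite doubleS -addn2 addnC leq_add2l; case: (odd (label_opp l)).
by rewrite perm_sort perm_map// perm_sym perm_sort.
Qed.

(** The sign is the lowest bit of a label, so [leq] sorts by index first. These are Fan's
    alternating simplices. *)
Definition fan (b : bool) (s : seq nat) : bool :=
  alternating b (map odd (sort leq s)).

Lemma perm_fan b s s' : perm_eq s s' -> fan b s = fan b s'.
Proof.
move=> ss'; rewrite /fan; congr (alternating _ (map _ _)).
by apply/perm_sortP => //; [exact: leq_total|exact: leq_trans|exact: anti_leq].
Qed.

Lemma fan_label_opp b s : compatible s ->
  fan b (map label_opp s) = fan (~~ b) s.
Proof.
move=> cs; rewrite /fan map_sort_label_opp// -alternating_negb -!map_comp.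
by congr alternating; apply: eq_map => l /=; rewrite odd_label_opp.
Qed.

Lemma cobd_fan b s : cobd (fan b) s = fan b s (+) fan (~~ b) s.
Proof.
rewrite (perm_cobd (@perm_fan b) (s' := sort leq s)); last by rewrite perm_sym perm_sort.
rewrite -cobd_alternating /cobd bd_map pairing_map.
apply: eq_in_pairing => t ts; rewrite /fan /= sorted_sort//; first exact: leq_trans.
apply: (subseq_sorted leq_trans (bd_subseq ts)); exact/sort_sorted/leq_total.
Qed.

(** Neighbours in the sorted list have opposite signs, hence are different labels; compatibility
    then forbids equal indices. *)
Lemma alternating_ltn_half b l s :
  path leq l s -> compatible (l :: s) -> alternating b (map odd (l :: s)) ->
  path ltn l./2 (map half s).
Proof.
elim: s b l => //= m s IH b l /andP[lm ms] cs /andP[/eqP ob].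
rewrite -/(alternating _ (map odd (m :: s))) => am.
have cms : compatible (m :: s).
  by move=> x y xs ys; apply: cs; rewrite in_cons ?xs ?ys orbT.
rewrite (IH _ _ ms cms am) andbT.
have /andP[/eqP om _] := am.
have : l./2 <> m./2.
  move=> /(cs l m); rewrite !in_cons !eqxx orbT => /(_ isT isT) e.
  by move: om; rewrite -e ob; case: (b).
have := half_leq lm; lia.
Qed.

Lemma fan_index_bound b (s : seq nat) N : compatible s ->
  {in s, forall l, (l./2 < N)%N} -> fan b s -> (size s <= N)%N.
Proof.
move=> cs sN fs; rewrite -(size_sort leq) -(size_map half) -(size_iota 0 N).
apply: uniq_leq_size; last first.
  by move=> _ /mapP[l + ->]; rewrite mem_sort mem_iota => /sN.
apply: (sorted_uniq ltn_trans ltnn).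
move: fs; rewrite /fan; have := sort_sorted leq_total s.
have : compatible (sort leq s) by move=> x y; rewrite !mem_sort; apply: cs.
by case: (sort leq s) => //= l s' h1 h2 h3; apply: (alternating_ltn_half h2 h1 h3).
Qed.

(** * Barycentric subdivision of hemispheres *)

Definition bdc (T : Type) (c : seq (seq T)) : seq (seq T) := flatten (map (@bd T) c).

(** Equality of chains over [F_2]: repeated simplices cancel in pairs. *)
Definition eqc (T : Type) (c c' : seq T) : Prop :=
  forall phi, pairing phi c = pairing phi c'.

Lemma pairing_bdc (T : Type) (phi : seq T -> bool) c :
  pairing phi (bdc c) = pairing (cobd phi) c.
Proof. by rewrite /bdc pairing_flatten pairing_map. Qed.

Lemma bdc_cone (T : Type) (x : T) c :
  eqc (bdc (map (cons x) c)) (c ++ map (cons x) (bdc c)).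
Proof.
move=> phi; rewrite pairing_bdc pairing_cat !pairing_map pairing_bdc.
by rewrite -pairing_add; apply: eq_pairing => s; rewrite /= cobd_cons.
Qed.

Definition negc (V : zmodType) (c : seq (seq V)) : seq (seq V) :=
  map (map (fun x => - x)) c.

Lemma negcK (V : zmodType) : involutive (@negc V).
Proof.
move=> c; rewrite /negc -map_comp map_id_in// => s _ /=.
by rewrite -map_comp map_id_in// => x _ /=; rewrite opprK.
Qed.

Lemma bdc_negc (V : zmodType) (c : seq (seq V)) : bdc (negc c) = negc (bdc c).
Proof.
rewrite /bdc /negc map_flatten -!map_comp; congr flatten.
by apply: eq_map => s /=; rewrite bd_map.
Qed.

Lemma eqc_negc (V : zmodType) (c c' : seq (seq V)) :
  eqc c c' -> eqc (negc c) (negc c').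
Proof. by move=> cc' phi; rewrite !pairing_map cc'. Qed.

(* [k+1]-st hemisphere: the cone with apex [e (k+1)] over the whole [k]-sphere. *)
Fixpoint hemi (V : zmodType) (e : nat -> V) (k : nat) : seq (seq V) :=
  if k is k'.+1 then map (cons (e k)) (hemi e k' ++ negc (hemi e k'))
  else [:: [:: e 0]].

Lemma size_hemi (V : zmodType) (e : nat -> V) k t :
  t \in hemi e k -> size t = k.+1.
Proof.
elim: k t => [|k IH] t /=; first by rewrite inE => /eqP ->.
move=> /mapP[u + ->] /=; rewrite mem_cat => /orP[/IH ->//|/mapP[w /IH + ->]].
by rewrite size_map => ->.
Qed.

(** A cone over a cycle has that cycle as its boundary. The equatorial sphere is a cycle because its
    two halves have the same boundary, which is invariant under negation. *)
Lemma bdc_hemi (V : zmodType) (e : nat -> V) k :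
  eqc (bdc (hemi e k.+1)) (hemi e k ++ negc (hemi e k)).
Proof.
suff closed : eqc (bdc (hemi e k ++ negc (hemi e k))) [::].
  move=> phi; rewrite [hemi e k.+1]/= bdc_cone pairing_cat pairing_map.
  by rewrite closed pairing_nil addbF.
elim: k => [|k IH] phi; first by rewrite /bdc /= !pairing_cons pairing_nil addbF addbb.
have hk : eqc (bdc (hemi e k.+1)) (hemi e k ++ negc (hemi e k)).
  move=> psi; rewrite [hemi e k.+1]/= bdc_cone pairing_cat pairing_map.
  by rewrite IH pairing_nil addbF.
rewrite {1}/bdc map_cat flatten_cat pairing_cat -!/(bdc _) bdc_negc.
rewrite (eqc_negc hk) hk /negc map_cat -!/(negc _) negcK !pairing_cat.
by rewrite [X in _ (+) X]addbC addbb pairing_nil.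
Qed.

(* Ky Fan's parity count: the number of alternating simplices (positive plus
   negative) has the same parity in every dimension, and is odd in dimension 0,
   whereas an alternating [N]-simplex needs [N + 1] different indices. *)
Lemma fan_hemispheres (V : zmodType) (H : nat -> seq (seq V)) (N : nat)
    (lab : V -> nat) :
  (forall k t, t \in H k -> size t = k.+1) ->
  eqc (bdc (H 0)) [:: [::]] ->
  (forall k, eqc (bdc (H k.+1)) (H k ++ negc (H k))) ->
  (forall k t x, (k <= N)%N -> t \in H k -> x \in t ->
     lab (- x) = label_opp (lab x) /\ ((lab x)./2 < N)%N) ->
  exists k t, [/\ (k <= N)%N, t \in H k & ~ compatible (map lab t)].
Proof.
move=> sH H0 HS Hlab; apply/not_existsP => noncompat.
have comp k t : (k <= N)%N -> t \in H k -> compatible (map lab t).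
  move=> kN tH; apply: contrapT => nc; apply: (noncompat k).
  by exists t.
pose al b (t : seq V) := fan b (map lab t).
have al_neg k t b : (k <= N)%N -> t \in H k ->
    al b (map (fun x => - x) t) = al (~~ b) t.
  move=> kN tH; rewrite /al -fan_label_opp; last exact: comp kN tH.
  congr fan; rewrite -!map_comp; apply/eq_in_map => x xt /=.
  by case: (Hlab _ _ _ _ tH xt).
have cobd_al t : cobd (al true) t = al true t (+) al false t.
  by rewrite /al -cobd_fan /cobd bd_map pairing_map.
(* A negative alternating simplex of [H k] is the antipode of a positive one of [negc (H k)]; so the
   positive ones of the sphere count all alternating ones of the hemisphere, which by [cobd_al] is
   the count on its boundary. *)
have sphereE k : (k <= N)%N ->
    pairing (al true) (H k ++ negc (H k)) = pairing (al true) (bdc (H k)).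
  move=> kN; rewrite pairing_cat pairing_map -pairing_add pairing_bdc.
  apply: eq_in_pairing => t tH; rewrite /= cobd_al; congr (_ (+) _).
  exact: al_neg tH.
have odd_al k : (k <= N)%N -> pairing (al true) (bdc (H k)).
  elim: k => [|k IH] kN; first by rewrite H0 pairing_cons pairing_nil.
  by rewrite HS sphereE ?IH// ltnW.
have := odd_al N (leqnn N); rewrite pairing_bdc (_ : pairing _ _ = false)//.
apply: big1_seq => t /= tH; rewrite cobd_al.
have al0 b : al b t = false.
  apply/negP => /(fan_index_bound (N := N) (comp _ _ (leqnn N) tH)).
  rewrite size_map (sH _ _ tH) ltnn => h; have // : false; apply: h.
  by move=> _ /mapP[x xt ->]; case: (Hlab _ _ _ _ tH xt).
by rewrite !al0.
Qed.

(** * Subdivision as a chain map, and its mesh *)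

Section Subdivision.
Variable R : realType.

Definition bary (V : lmodType R) (s : seq V) : V :=
  (size s)%:R^-1 *: \sum_(x <- s) x.

(** [k] is meant to be the number of vertices of [s]; it drives the recursion because the faces of
    [s] are not structurally smaller. *)
Fixpoint sd (V : lmodType R) (k : nat) (s : seq V) : seq (seq V) :=
  if k is k'.+1 then map (cons (bary s)) (flatten (map (sd k') (bd s)))
  else [:: s].

Definition sdc (V : lmodType R) (k : nat) (c : seq (seq V)) : seq (seq V) :=
  flatten (map (sd k) c).

Lemma sdcS (V : lmodType R) k (s : seq V) :
  sd k.+1 s = map (cons (bary s)) (sdc k (bd s)).
Proof. by []. Qed.

Lemma pairing_sdc (V : lmodType R) k (phi : seq V -> bool) c :
  pairing phi (sdc k c) = pairing (fun s => pairing phi (sd k s)) c.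
Proof. by rewrite /sdc pairing_flatten pairing_map. Qed.

Lemma eqc_sdc (V : lmodType R) k (c c' : seq (seq V)) :
  eqc c c' -> eqc (sdc k c) (sdc k c').
Proof. by move=> cc' phi; rewrite !pairing_sdc cc'. Qed.

Lemma size_sd (V : lmodType R) k (s t : seq V) :
  size s = k -> t \in sd k s -> size t = k.
Proof.
elim: k s t => [|k IH] s t sk /=; first by rewrite inE => /eqP ->.
move=> /mapP[u /flattenP[_ /mapP[w ws ->] uw] ->] /=; congr _.+1.
by apply: IH uw; have /allP/(_ _ ws)/eqP := size_bd s; rewrite sk.
Qed.

(** The boundary of a cone is its base plus the cone over the boundary of the base. By induction
    this second part is a cone over the subdivision of a double boundary, and so vanishes. *)
Lemma sdc_bdc (V : lmodType R) k (c : seq (seq V)) :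
  {in c, forall s, size s = k.+1} -> eqc (bdc (sdc k.+1 c)) (sdc k (bdc c)).
Proof.
have sd_bd j (s : seq V) phi : size s = j.+1 ->
    pairing (cobd phi) (sd j.+1 s) = pairing phi (sdc j (bd s)).
  elim: j s phi => [|j IH] s phi sj.
    rewrite -pairing_bdc sdcS bdc_cone pairing_cat; case: s sj => [|x []]//= _.
    by rewrite pairing_nil addbF.
  rewrite -pairing_bdc sdcS bdc_cone pairing_cat pairing_map pairing_bdc.
  rewrite -[RHS]addbF; congr (_ (+) _); rewrite pairing_sdc.
  (* The summand [false] on the right is rewritten as a double coboundary, to be compared term by
     term. *)
  rewrite -(cobd_cobd (fun u => pairing (phi \o cons (bary s)) (sd j u)) s).
  apply: eq_in_pairing => t ts; rewrite IH ?pairing_sdc//.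
  by have /allP/(_ _ ts)/eqP := size_bd s; rewrite sj.
move=> ck phi; rewrite pairing_bdc pairing_sdc (eq_in_pairing (psi := fun s =>
  pairing phi (sdc k (bd s)))) => [|s /ck sk]; last exact: sd_bd.
by rewrite pairing_sdc pairing_bdc; apply: eq_pairing => s; rewrite pairing_sdc.
Qed.

Lemma sd_opp (V : lmodType R) k (s : seq V) :
  sd k (map (fun x => - x) s) = negc (sd k s).
Proof.
elim: k s => [|k IH] s //=.
rewrite /negc bd_map map_flatten -!map_comp map_flatten -!map_comp.
congr flatten; apply: eq_map => t /=; rewrite IH /negc -!map_comp.
apply: eq_map => u /=; congr (_ :: _).
by rewrite /bary size_map big_map sumrN scalerN.
Qed.

Lemma sdc_negc (V : lmodType R) k (c : seq (seq V)) :
  sdc k (negc c) = negc (sdc k c).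
Proof.
rewrite /sdc /negc map_flatten -!map_comp; congr flatten.
by apply: eq_map => s; rewrite /= sd_opp.
Qed.

Lemma iter_sdc_size (V : lmodType R) m k (c : seq (seq V)) :
  {in c, forall s, size s = k} -> {in iter m (sdc k) c, forall s, size s = k}.
Proof.
move=> ck; elim: m => //= m IH s /flattenP[_ /mapP[t /IH tk ->]].
exact: size_sd.
Qed.

Lemma iter_sdc_negc (V : lmodType R) m k (c : seq (seq V)) :
  iter m (sdc k) (negc c) = negc (iter m (sdc k) c).
Proof. by elim: m => //= m ->; rewrite sdc_negc. Qed.

Lemma iter_sdc_cat (V : lmodType R) m k (c c' : seq (seq V)) :
  iter m (sdc k) (c ++ c') = iter m (sdc k) c ++ iter m (sdc k) c'.
Proof. by elim: m => //= m ->; rewrite /sdc map_cat flatten_cat. Qed.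

Lemma iter_eqc_sdc (V : lmodType R) m k (c c' : seq (seq V)) :
  eqc c c' -> eqc (iter m (sdc k) c) (iter m (sdc k) c').
Proof. by move=> cc'; elim: m => //= m; apply: eqc_sdc. Qed.

Lemma iter_sdc_bdc (V : lmodType R) m k (c : seq (seq V)) :
  {in c, forall s, size s = k.+1} ->
  eqc (bdc (iter m (sdc k.+1) c)) (iter m (sdc k) (bdc c)).
Proof.
move=> ck; elim: m => //= m IH phi; rewrite sdc_bdc; last exact: iter_sdc_size.
exact: eqc_sdc.
Qed.

(** Serves for balls and for level sets of linear forms, both closed under barycentres. *)
Lemma sd_convex (V : lmodType R) (P : V -> Prop) k (s : seq V) :
  (forall u : seq V, (0 < size u)%N -> (forall x, x \in u -> P x) -> P (bary u)) ->
  size s = k -> (forall x, x \in s -> P x) ->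
  forall t, t \in sd k s -> forall x, x \in t -> P x.
Proof.
move=> Pbary; elim: k s => [|k IH] s sk Ps t /=; first by rewrite inE => /eqP ->.
move=> /mapP[u /flattenP[_ /mapP[w ws ->] uw] ->] x.
rewrite in_cons => /orP[/eqP ->|]; first by apply: Pbary; rewrite ?sk.
apply: IH uw x; first by have /allP/(_ _ ws)/eqP := size_bd s; rewrite sk.
by move=> x /(mem_subseq (bd_subseq ws)) /Ps.
Qed.

Lemma bary_sub (V : lmodType R) (c : V) (u : seq V) : (0 < size u)%N ->
  bary u - c = (size u)%:R^-1 *: \sum_(x <- u) (x - c).
Proof.
move=> u0; rewrite sumrB scalerBr; congr (_ - _).
rewrite big_const_seq count_predT iter_addr_0 -[c *+ _]scaler_nat scalerA mulVf ?scale1r//.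
by rewrite pnatr_eq0 -lt0n.
Qed.

Lemma ball_bary (V : normedModType R) (c : V) (r : R) (u : seq V) :
  (0 < size u)%N -> (forall x, x \in u -> `|c - x| <= r) -> `|c - bary u| <= r.
Proof.
move=> u0 ur; rewrite distrC bary_sub// normrZ ger0_norm ?invr_ge0// ler_pdivrMl ?ltr0n//.
apply: (le_trans (ler_norm_sum _ _ _)); rewrite big_seq.
apply: (@le_trans _ _ (\sum_(x <- u | x \in u) r)).
  by apply: ler_sum => x /ur; rewrite distrC.
by rewrite -big_seq big_const_seq count_predT iter_addr_0 mulr_natl.
Qed.

(** The barycentre of [k.+1] vertices is within [k / k.+1 * d] of each of them, hence of all
    vertices of the subdivided faces, since balls are convex. Edges missing the barycentre lie in a
    subdivided face. *)
Lemma sd_mesh (V : normedModType R) N k (s : seq V) (d : R) :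
  (k <= N.+1)%N -> size s = k ->
  {in s &, forall x y, `|x - y| <= d} ->
  forall t, t \in sd k s ->
  {in t &, forall x y, `|x - y| <= N%:R / N.+1%:R * d}.
Proof.
elim: k s => [|k IH] s kN sk sdd t /=.
  by rewrite inE => /eqP ->; rewrite (size0nil sk).
move=> /mapP[u /flattenP[_ /mapP[w ws ->] uw] ->].
have sw : size w = k by have /allP/(_ _ ws)/eqP := size_bd s; rewrite sk.
have wsub := mem_subseq (bd_subseq ws).
have meshu : {in u &, forall x y, `|x - y| <= N%:R / N.+1%:R * d}.
  apply: (IH w) uw => //; first exact: ltnW.
  by move=> x y /wsub xs /wsub; apply: sdd.
have d0 : 0 <= d.
  have [x xs] : exists x, x \in s.
    by case: (s) sk => // x s' _; exists x; apply: mem_head.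
  by have := sdd x x xs xs; rewrite subrr normr0.
have barys x : x \in s -> `|bary s - x| <= N%:R / N.+1%:R * d.
  move=> xs; rewrite bary_sub ?sk// normrZ ger0_norm ?invr_ge0//.
  (* Of the [k.+1] differences in the average, the one at [x] itself is zero. *)
  rewrite (perm_big _ (perm_to_rem xs)) big_cons /= subrr add0r.
  have sumle : `|\sum_(y <- rem x s) (y - x)| <= k%:R * d.
    apply: (le_trans (ler_norm_sum _ _ _)); rewrite big_seq.
    apply: (@le_trans _ _ (\sum_(y <- rem x s | y \in rem x s) d)).
      by apply: ler_sum => y /mem_rem ys; apply: sdd.
    by rewrite -big_seq big_const_seq count_predT iter_addr_0 size_rem// sk mulr_natl.
  rewrite ler_pdivrMl ?ltr0n//; apply: (le_trans sumle).
  rewrite mulrA ler_wpM2r// mulrA ler_pdivlMr ?ltr0n// -!natrM ler_nat.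
  by rewrite mulnS mulSn leq_add2r.
have tail x : x \in u -> `|bary s - x| <= N%:R / N.+1%:R * d.
  apply: (sd_convex (P := fun x => `|bary s - x| <= N%:R / N.+1%:R * d) _ sw _ uw).
    by move=> v; apply: ball_bary.
  by move=> y /wsub; apply: barys.
move=> x y; rewrite !in_cons => /orP[/eqP ->|xu] /orP[/eqP ->|yu].
- by rewrite subrr normr0 mulr_ge0// divr_ge0.
- exact: tail.
- by rewrite distrC; apply: tail.
- exact: meshu.
Qed.
End Subdivision.

(** * The Borsuk-Ulam theorem *)

Section BorsukUlam.
Variable R : realType.

Lemma dotr0 n (u : 'rV[R]_n) : dot u 0 = 0.
Proof. by rewrite -(scale0r 0) dotZr mul0r. Qed.

Lemma coord_le_norm n (x : 'rV[R]_n) i : `|x 0 i| <= `|x|.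
Proof.
rewrite [leRHS]/Num.norm /= mx_normrE; apply/bigmax_geP; right => /=.
by exists (0, i).
Qed.

Lemma norm_le_coord n (x : 'rV[R]_n) c :
  0 <= c -> (forall i, `|x 0 i| <= c) -> `|x| <= c.
Proof.
move=> c0 xc; rewrite [leLHS]/Num.norm /= mx_normrE; apply/bigmax_leP; split=> //=.
by move=> [i j] _ /=; rewrite ord1.
Qed.

(* Signed indicator of the orthant containing the simplex [t]. *)
Lemma hemi_orthant N k (t : seq 'rV[R]_N.+1) :
  (k <= N)%N -> t \in hemi (fun j => delta_mx 0 (inord j)) k ->
  exists a : 'rV[R]_N.+1,
    [/\ forall j, `|a 0 j| <= 1, forall j : 'I_N.+1, (k < j)%N -> a 0 j = 0 &
        forall x, x \in t -> [/\ dot a x = 1, `|x| <= 1 &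
                                 forall j : 'I_N.+1, (k < j)%N -> x 0 j = 0]].
Proof.
pose e (j : nat) : 'rV[R]_N.+1 := delta_mx 0 (inord j).
have e_dot a j : dot a (e j) = a 0 (inord j).
  rewrite /dot (bigD1 (inord j))//= !mxE !eqxx mulr1 big1 ?addr0// => i ij.
  by rewrite mxE (negPf ij) andbF mulr0.
have e_coord j i : e j 0 i = (i == inord j)%:R by rewrite mxE eqxx.
have e_norm j : `|e j| <= 1.
  by apply: norm_le_coord => // i; rewrite e_coord; case: eqP; rewrite ?normr0 ?normr1.
have e_gt k' (i : 'I_N.+1) : (k' <= N)%N -> (k' < i)%N -> e k' 0 i = 0.
  by move=> kN ki; rewrite e_coord; case: eqP => // ik; move: ki; rewrite ik inordK// ltnn.
elim: k t => [|k IH] t kN.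
  rewrite inE => /eqP ->; exists (e 0); split=> [j|j|x].
  - exact: le_trans (coord_le_norm _ _) (e_norm 0%N).
  - exact: e_gt.
  rewrite inE => /eqP ->; rewrite e_dot e_coord eqxx; split=> //.
    exact: (e_norm 0%N).
  by move=> j; apply: (e_gt 0%N).
have {}IH u : u \in hemi e k ++ negc (hemi e k) -> exists a : 'rV[R]_N.+1,
    [/\ forall j, `|a 0 j| <= 1, forall j : 'I_N.+1, (k < j)%N -> a 0 j = 0 &
        forall x, x \in u -> [/\ dot a x = 1, `|x| <= 1 &
                                 forall j : 'I_N.+1, (k < j)%N -> x 0 j = 0]].
  rewrite mem_cat => /orP[|/mapP[w wh ->]]; first by apply: IH; apply: ltnW.
  have [a [a1 a0 aw]] := IH w (ltnW kN) wh.
  exists (- a); split=> [j|j kj|_ /mapP[x /aw[ax x1 x0] ->]].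
  - by rewrite mxE normrN.
  - by rewrite mxE a0// oppr0.
  rewrite dotNl dotNr opprK normrN; split=> // j kj.
  by rewrite mxE x0// oppr0.
rewrite [hemi _ _]/= => /mapP[u /IH[a [a1 a0 au]] ->].
have kk : (k < (inord k.+1 : 'I_N.+1))%N by rewrite inordK.
(* Coordinate [k.+1] is zero for [a] and on the base, so the added term only raises the value at the
   apex from 0 to 1. *)
exists (a + e k.+1); split=> [j|j kj|x].
- rewrite mxE e_coord; case: eqP => [->|_]; last by rewrite addr0.
  by rewrite a0// add0r normr1.
- by rewrite mxE a0 ?add0r ?e_gt// ltnW.
rewrite inE => /orP[/eqP ->|/au[ax x1 x0]].
  rewrite dotDl !e_dot a0// add0r e_coord eqxx; split=> //; first exact: (e_norm k.+1).
  by move=> j; apply: e_gt.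
rewrite dotDl ax dotC e_dot x0// addr0; split=> // j kj; apply: x0.
exact: ltnW.
Qed.

(** * Labelling by the largest coordinate *)

Definition amax N (v : 'rV[R]_N.+1) : 'I_N.+1 :=
  [arg max_(i > ord0) `|v 0 i|]%O.

Lemma amaxN N (v : 'rV[R]_N.+1) : amax (- v) = amax v.
Proof.
rewrite /amax; congr (Order.arg_max _ _ _).
by apply/funext => i; rewrite mxE normrN.
Qed.

Lemma norm_amax N (v : 'rV[R]_N.+1) : `|v 0 (amax v)| = `|v|.
Proof.
apply/eqP; rewrite eq_le coord_le_norm norm_le_coord// => i.
by rewrite /amax; case: arg_maxP => // j _ /(_ i isT).
Qed.

Definition sign_label N (v : 'rV[R]_N.+1) : nat :=
  (0 < v 0 (amax v))%R + (amax v).*2.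

Lemma sign_labelN N (v : 'rV[R]_N.+1) : v != 0 ->
  sign_label (- v) = label_opp (sign_label v).
Proof.
rewrite -normr_eq0 -norm_amax normr_eq0 => v0.
rewrite /sign_label amaxN mxE oppr_gt0 /label_opp oddD odd_double addbF oddb.
by case: ltrgt0P v0.
Qed.

Lemma half_sign_label N (v : 'rV[R]_N.+1) : (sign_label v)./2 = amax v.
Proof. exact: half_bit_double. Qed.

(** If two values of [F] are within [|F x| / 2] of [F x], their common largest coordinate exceeds
    [|F x| / 2] in absolute value for both, yet differs by less than [|F x|]; so the signs agree.
    Compactness makes the radius uniform. *)
Lemma sign_label_close M N (F : 'rV[R]_M -> 'rV[R]_N.+1) (K : set 'rV[R]_M) :
  compact K -> (forall x, K x -> {for x, continuous F}) ->
  (forall x, K x -> F x != 0) ->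
  exists2 eta : R, 0 < eta & forall x y, K x -> `|x - y| < eta ->
    amax (F x) = amax (F y) -> sign_label (F x) = sign_label (F y).
Proof.
move=> /compact_near_coveringP cK Fcont F0.
pose P (eta : R) (x : 'rV[R]_M) := forall y, `|x - y| < eta ->
    amax (F x) = amax (F y) -> sign_label (F x) = sign_label (F y).
have : \forall eta \near 0^'+, K `<=` P eta.
  apply: cK => x Kx.
  have d0 : 0 < `|F x| / 2 by rewrite divr_gt0// normr_gt0 F0.
  have /nbhs_ballP[r /= r0 xr] : nbhs x [set z | `|F x - F z| < `|F x| / 2].
    by have /cvgrPdist_lt := Fcont x Kx; apply.
  have r2 : 0 < r / 2 by rewrite divr_gt0.
  exists (ball x (r / 2), [set eta | eta < r / 2]) => /=.
    split; [exact: nbhsx_ballx|exact: nbhs_right_lt].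
  move=> [z eta] /= [xz etar] y zy ezy.
  have Fz : `|F x - F z| < `|F x| / 2.
    by apply: xr; apply: le_ball xz; rewrite ler_piMr// ?invf_le1 ?ler1n// ltW.
  have Fy : `|F x - F y| < `|F x| / 2.
    apply: xr; rewrite -ball_normE /=; move: xz; rewrite -ball_normE /= => xz.
    have := ler_distD z x y; lra.
  rewrite /sign_label -ezy; congr (_ + _)%N; congr nat_of_bool.
  set i := amax (F z).
  have zi : `|F z 0 i| > `|F x| / 2.
    by rewrite norm_amax; have := ler_distD (F z) (F x) 0; rewrite !subr0; lra.
  have zyi : `|F z 0 i - F y 0 i| < `|F x|.
    have := coord_le_norm (F z - F y) i; rewrite !mxE.
    have := ler_distD (F x) (F z) (F y); rewrite (distrC (F z) (F x)); lra.
  have yi : `|F y 0 i| > `|F x| / 2.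
    rewrite /i ezy norm_amax.
    by have := ler_distD (F y) (F x) 0; rewrite !subr0; lra.
  move: zi zyi yi; case: (ltP 0 (F z 0 i)); case: (ltP 0 (F y 0 i)) => //.
    by move=> y0 z0; rewrite (gtr0_norm z0) (ler0_norm y0) ltr_norml; lra.
  by move=> y0 z0; rewrite (gtr0_norm y0) (ler0_norm z0) ltr_norml; lra.
case=> eta0 /= eta00 etaP.
exists (eta0 / 2); first by rewrite divr_gt0.
move=> x y Kx; apply: (etaP (eta0 / 2)) => //=; last by rewrite divr_gt0.
rewrite sub0r normrN gtr0_norm ?divr_gt0//.
by rewrite ltr_pdivrMr// ltr_pMr// ltr1n.
Qed.

(** Working on the punctured space allows the octahedral sphere to be used without normalising its
    points. *)
Theorem borsuk_ulam N (F : 'rV[R]_N.+1 -> 'rV[R]_N) :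
  (forall x, x != 0 -> {for x, continuous F}) ->
  (forall x, x != 0 -> F (- x) = - F x) ->
  exists2 x, x != 0 & F x = 0.
Proof.
(* A target of dimension 0 is treated apart, since [amax] needs a coordinate. *)
case: N F => [|N] F Fcont Fodd.
  exists (delta_mx 0 0); last by apply/rowP => -[].
  by apply/eqP => /rowP/(_ 0); rewrite !mxE => /eqP; rewrite oner_eq0.
apply: contrapT => /forall2NP noroot.
have F0 x : x != 0 -> F x != 0.
  by move=> x0; apply/eqP => Fx; case: (noroot x).
(* A point with l1 norm 1 has a coordinate of size at least [N.+2%:R^-1]; so [K] contains the
   octahedral sphere and avoids 0. *)
pose K := [set x : 'rV[R]_N.+2 | `|x| <= 1 /\ N.+2%:R^-1 <= `|x|].
have K0 x : K x -> x != 0.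
  move=> [_ xN]; rewrite -normr_gt0; apply: lt_le_trans xN.
  by rewrite invr_gt0 ltr0n.
have cK : compact K.
  apply: bounded_closed_compact.
    exists 1; split; first exact: num_real.
    by move=> M M1 x [x1 _]; apply: le_trans x1 (ltW M1).
  apply: (@closedI _ [set x : 'rV[R]_N.+2 | `|x| <= 1]
                     [set x : 'rV[R]_N.+2 | N.+2%:R^-1 <= `|x|]).
    apply: (@preimage_closed _ _ (fun x : 'rV[R]_N.+2 => `|x|) [set y : R | y <= 1]);
      [move=> x _; exact: norm_continuous|exact: closed_le].
  apply: (@preimage_closed _ _ (fun x : 'rV[R]_N.+2 => `|x|) [set y : R | _ <= y]);
    [move=> x _; exact: norm_continuous|exact: closed_ge].
have [eta eta0 close] := sign_label_close cK (fun x Kx => Fcont x (K0 x Kx))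
  (fun x Kx => F0 x (K0 x Kx)).
(* The mesh factor for simplices with at most [N.+2] vertices; the 2 below bounds the diameter of
   the unit ball. *)
pose c : R := N.+1%:R / N.+2%:R.
have c0 : 0 <= c by rewrite divr_ge0.
have [m mesh] : exists m, c ^+ m * 2 < eta.
  have c1 : `|c| < 1.
    by rewrite ger0_norm// ltr_pdivrMr ?ltr0n// mul1r ltr_nat.
  have /cvgr0_norm_lt/(_ _ eta0)[m _ /(_ m (leqnn m))] := cvg_geometric 2 c1.
  rewrite /geometric /= => hm; exists m; apply: le_lt_trans hm.
  by rewrite mulrC ler_norm.
pose h k := hemi (fun j => delta_mx 0 (inord j) : 'rV[R]_N.+2) k.
pose H k := iter m (sdc k.+1) (h k).
have sH m' k t : t \in iter m' (sdc k.+1) (h k) -> size t = k.+1.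
  by apply: iter_sdc_size => s; apply: size_hemi.
(* Subdivision preserves that the linear form [a] equals 1 on the simplex, which keeps the vertices
   away from 0. *)
have Hgeo m' k t : (k <= N.+1)%N -> t \in iter m' (sdc k.+1) (h k) ->
    (exists2 a : 'rV[R]_N.+2, forall j, `|a 0 j| <= 1 &
       forall x, x \in t -> dot a x = 1 /\ `|0 - x| <= 1) /\
    {in t &, forall x y, `|x - y| <= c ^+ m' * 2}.
  move=> kN; elim: m' t => [|m' IH] t /=.
    move=> /(hemi_orthant kN)[a [a1 _ at1]]; split.
      by exists a => // x /at1[ax x1 _]; rewrite sub0r normrN.
    move=> x y /at1[_ x1 _] /at1[_ y1 _]; rewrite expr0 mul1r.
    by have := ler_normB x y; lra.
  move=> /flattenP[_ /mapP[s sHm ->] ts]; have [[a a1 as1] smesh] := IH s sHm.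
  have sk := sH _ _ _ sHm.
  split; last by rewrite exprS -mulrA; apply: (sd_mesh _ sk smesh ts).
  exists a => //; apply: (sd_convex _ sk as1 ts) => u u0 au; split; last first.
    by apply: ball_bary => // x /au[].
  rewrite /bary dotZr (big_morph (dot a) (fun x y => dotDr x y a) (dotr0 a)).
  rewrite big_seq (eq_bigr (fun=> 1)) => [|x /au[]//].
  rewrite -big_seq big_const_seq count_predT iter_addr_0 mulVf//.
  by rewrite pnatr_eq0 -lt0n.
have HK k t x : (k <= N.+1)%N -> t \in H k -> x \in t -> K x.
  move=> kN /(Hgeo _ _ _ kN)[[a a1 at1] _] /at1[ax x1].
  rewrite sub0r normrN in x1; split=> //.
  rewrite -[leLHS]mul1r ler_pdivrMr ?ltr0n// -[leLHS]ax.
  apply: (@le_trans _ _ (\sum_(j < N.+2) `|x|)); last first.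
    by rewrite sumr_const card_ord mulr_natr.
  apply: ler_sum => j _; apply: le_trans (ler_norm _) _; rewrite normrM.
  by rewrite -[leRHS]mul1r ler_pM// coord_le_norm.
pose lab x := sign_label (F x).
have H0 : eqc (bdc (H 0)) [:: [::]].
  move=> phi; rewrite iter_sdc_bdc; last by move=> s; apply: size_hemi.
  by rewrite (_ : iter _ _ _ = [:: [::]])//; elim: (m) => //= m' ->.
have HS k : eqc (bdc (H k.+1)) (H k ++ negc (H k)).
  move=> phi; rewrite iter_sdc_bdc; last by move=> s; apply: size_hemi.
  by rewrite (iter_eqc_sdc _ _ (@bdc_hemi _ _ _)) iter_sdc_cat iter_sdc_negc.
(* There are [N.+1] indices, one fewer than the vertices of a top simplex. *)
have [||k [t [kN tH ncomp]]] := @fan_hemispheres _ H N.+1 lab _ H0 HS.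
- by move=> k t; apply: sH.
- move=> k t x kN tH xt; have x0 := K0 _ (HK _ _ _ kN tH xt).
  by rewrite /lab Fodd// sign_labelN ?F0// half_sign_label.
apply: ncomp => _ _ /mapP[x xt ->] /mapP[y yt ->]; rewrite !half_sign_label => xy.
apply: close; first exact: (HK _ _ _ kN tH xt).
  have [_ tm] := Hgeo _ _ _ kN tH; apply: le_lt_trans mesh; exact: tm.
exact: val_inj.
Qed.
End BorsukUlam.

(** * A regular simplex spinning to its antipode *)

Section RotatingSimplex.
Variable R : realType.

Lemma enormZ m (a : R) (u : 'rV[R]_m) : enorm (a *: u) = `|a| * enorm u.
Proof.
by rewrite /enorm dotZl dotZr mulrA -expr2 sqrtrM ?sqr_ge0// sqrtr_sqr.
Qed.

Lemma dot_eq0 m (u : 'rV[R]_m) : dot u u = 0 -> u = 0.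
Proof.
move=> /eqP; rewrite psumr_eq0 => [|i _]; last by rewrite -expr2 sqr_ge0.
move=> /allP u0; apply/rowP => i; rewrite mxE.
have := u0 i (mem_index_enum i); rewrite -expr2 sqrf_eq0 => /eqP//.
Qed.

Lemma enorm_ge0 m (u : 'rV[R]_m) : 0 <= enorm u.
Proof. exact: sqrtr_ge0. Qed.

Lemma enorm0 m : enorm (0 : 'rV[R]_m) = 0.
Proof. by rewrite /enorm dotr0 sqrtr0. Qed.

Lemma enorm_gt0 m (u : 'rV[R]_m) : (0 < enorm u) = (u != 0).
Proof.
rewrite lt_neqAle enorm_ge0 andbT eq_sym; congr negb; apply/eqP/eqP => [|->].
  move=> /eqP; rewrite sqrtr_eq0 => u0; apply: dot_eq0; apply/eqP.
  by rewrite eq_le u0 dot_ge0.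
exact: enorm0.
Qed.

Lemma enormN m (u : 'rV[R]_m) : enorm (- u) = enorm u.
Proof. by rewrite /enorm dotNl dotNr opprK. Qed.

Lemma sphere_normalize n (u : 'rV[R]_n.+1) : u != 0 ->
  sphere R n ((enorm u)^-1 *: u).
Proof.
rewrite -enorm_gt0 => u0; rewrite /sphere /= enormZ gtr0_norm ?invr_gt0//.
by rewrite mulVf// gt_eqF.
Qed.

(** For [w = 0] the quotient is 0 by convention and the map is the identity, still an isometry. *)
Definition reflection m (w x : 'rV[R]_m) : 'rV[R]_m :=
  x - (2 * dot x w / dot w w) *: w.

Lemma dot_reflection m (w x y : 'rV[R]_m) :
  dot (reflection w x) (reflection w y) = dot x y.
Proof.
rewrite /reflection dotDl !dotDr !dotNl !dotNr !dotZl !dotZr (dotC w y).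
have [->|w0] := eqVneq (dot w w) 0; first by rewrite invr0; ring.
by field.
Qed.

Lemma reflectionB m (w x y : 'rV[R]_m) :
  reflection w (x - y) = reflection w x - reflection w y.
Proof.
by apply/rowP => j; rewrite !mxE dotDl dotNl; ring.
Qed.

Lemma reflection_to m (u v : 'rV[R]_m) : dot u u = dot v v ->
  reflection (u - v) u = v.
Proof.
move=> uv; rewrite /reflection; have [/dot_eq0 w0|w0] := eqVneq (dot (u - v) (u - v)) 0.
  by rewrite w0 scaler0 subr0; apply/eqP; rewrite -subr_eq0 w0.
rewrite (_ : 2 * _ = dot (u - v) (u - v)).
  by rewrite divff// scale1r opprB addrC subrK.
by rewrite dot_subE -uv dotDr dotNr; ring.
Qed.

(** A form of being an inscribed regular simplex that passes through isometries at once. *)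
Definition regular_gram n (v : 'I_n.+2 -> 'rV[R]_n.+1) : Prop :=
  forall i j, dot (v i) (v j) = if i == j then 1 else - n.+1%:R^-1.

Lemma ex_regular_gram n : exists v : 'I_n.+2 -> 'rV[R]_n.+1, regular_gram v.
Proof.
have [v hv] := ex_inscribed_regular_simplex R n; exists v => i j.
case: eqVneq => [->|ij]; last exact: simplex_dot.
by case: hv => _ /(_ j)/sphereE.
Qed.

(** Each vertex is orthogonal to the sum, so the sum is orthogonal to itself. *)
Lemma sum_regular_gram n (v : 'I_n.+2 -> 'rV[R]_n.+1) :
  regular_gram v -> \sum_i v i = 0.
Proof.
move=> hv; apply: dot_eq0; rewrite dot_sumr big1// => i _.
rewrite dotC dot_sumr (bigD1 i)//= hv eqxx (eq_bigr (fun=> - n.+1%:R^-1)).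
  rewrite sumr_const cardC1 card_ord -[(- _) *+ _]mulr_natr mulNr mulVf ?subrr//.
by move=> j ji; rewrite hv eq_sym (negPf ji).
Qed.

Definition flip_coord n (m : 'I_n) (x : 'rV[R]_n) : 'rV[R]_n :=
  \row_j (if j == m then - x 0 j else x 0 j).

(** Once an edge is parallel to axis [m], the flip is the reflection in its bisecting hyperplane: it
    swaps the two ends and fixes the other vertices, which are equidistant from them. *)
Lemma ex_flip_simplex n (m : 'I_n.+1) :
  exists2 v : 'I_n.+2 -> 'rV[R]_n.+1, regular_gram v &
    exists p : {perm 'I_n.+2}, forall i, flip_coord m (v i) = v (p i).
Proof.
have [v0 hv0] := ex_regular_gram n.
pose i0 : 'I_n.+2 := ord0; pose i1 : 'I_n.+2 := lift ord0 ord0.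
pose u := v0 i0 - v0 i1; pose c := enorm u.
pose e : 'rV[R]_n.+1 := delta_mx 0 m.
have e_dot x : dot x e = x 0 m.
  rewrite /dot (bigD1 m)//= !mxE !eqxx mulr1 big1 ?addr0// => i im.
  by rewrite mxE (negPf im) andbF mulr0.
have c2 : c * c = 2 + 2 * n.+1%:R^-1.
  rewrite -expr2 sqr_sqrtr ?dot_ge0// /u dot_subE !hv0 !eqxx /=; ring.
have c0 : c != 0.
  apply/eqP => c0; move: c2; rewrite c0 mul0r => /esym/eqP.
  by rewrite gt_eqF// addr_gt0// mulr_gt0// invr_gt0 ltr0n.
(* This reflection carries the edge [u] to [c *: e]. *)
pose v i := reflection (u - c *: e) (v0 i).
have hv : regular_gram v by move=> i j; rewrite dot_reflection hv0.
have v01 : v i0 - v i1 = c *: e.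
  rewrite -reflectionB reflection_to// dotZl dotZr e_dot !mxE !eqxx mulr1.
  by rewrite /c -expr2 sqr_sqrtr ?dot_ge0.
have vm i : c * v i 0 m = dot (v i) (v i0) - dot (v i) (v i1).
  by rewrite -dotNr -dotDr v01 dotZr e_dot.
exists v => //; exists (tperm i0 i1) => i.
have flipE x : flip_coord m x = x - (2 * x 0 m) *: e.
  by apply/rowP => j; rewrite !mxE eqxx; case: eqP => [->|_] /=; ring.
rewrite flipE; case: tpermP => [->|->|/eqP ii0 /eqP ii1].
- rewrite (_ : 2 * _ = c); first by rewrite -v01 opprB addrC subrK.
  apply: (mulfI c0); rewrite mulrCA vm !hv eqxx /= c2; ring.
- rewrite (_ : 2 * _ = - c); first by rewrite scaleNr opprK -v01 addrC subrK.
  apply: (mulfI c0); rewrite mulrCA vm !hv eqxx /= mulrN c2; ring.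
rewrite (_ : 2 * _ = 0) ?scale0r ?subr0//.
by apply: (mulfI c0); rewrite mulrCA vm !hv (negPf ii0) (negPf ii1) subrr !mulr0.
Qed.

(* Rotation by the angle of [(c, s)] in each plane spanned by the coordinates
   [j] and [rev_ord j]; the middle coordinate, if there is one, is fixed. *)
Definition spin n (c s : R) (x : 'rV[R]_n) : 'rV[R]_n :=
  \row_j (if j == rev_ord j then x 0 j
          else c * x 0 j + s * (if (j < rev_ord j)%N then x 0 (rev_ord j)
                                else - x 0 (rev_ord j))).

(** Twice the inner product is a sum over the pairs of [j] and [rev_ord j], each of which is rotated
    or fixed. *)
Lemma dot_spin n (c s : R) (x y : 'rV[R]_n) : c * c + s * s = 1 ->
  dot (spin c s x) (spin c s y) = dot x y.
Proof.
move=> cs; have dot2 (u v : 'rV[R]_n) :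
    2 * dot u v = \sum_j (u 0 j * v 0 j + u 0 (rev_ord j) * v 0 (rev_ord j)).
  rewrite big_split /= mulr2n mulrDl !mul1r; congr (_ + _).
  by rewrite /dot (reindex_inj rev_ord_inj).
have n2 : 2 != 0 :> R by rewrite pnatr_eq0.
apply: (mulfI n2); rewrite !dot2; apply: eq_bigr => j _.
rewrite !mxE rev_ordK; have [<-//|jr] := eqVneq j (rev_ord j).
have -> : (rev_ord j < j)%N = ~~ (j < rev_ord j)%N.
  by rewrite -leqNgt ltn_neqAle [_ == _](_ : _ = (rev_ord j == j)) // eq_sym jr.
rewrite -[RHS]mul1r -cs.
by case: (j < rev_ord j)%N => /=; ring.
Qed.

(** Negating [(c, s)] negates every coordinate but the middle one. In even dimension there is none
    and any simplex works; in odd dimension the simplex has to be symmetric under the flip of the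
    middle coordinate. *)
Lemma ex_spinning_simplex n :
  exists2 v : 'I_n.+2 -> 'rV[R]_n.+1, regular_gram v &
    exists p : {perm 'I_n.+2}, forall c s i,
      spin (- c) (- s) (v i) = - spin c s (v (p i)).
Proof.
have spinN (S : 'rV[R]_n.+1 -> 'rV[R]_n.+1) :
    (forall x j, S x 0 j = if j == rev_ord j then - x 0 j else x 0 j) ->
    forall c s x, spin (- c) (- s) x = - spin c s (S x).
  move=> SE c s x; apply/rowP => j; rewrite !mxE !SE rev_ordK.
  have [jr|jr] := eqVneq j (rev_ord j); first by rewrite opprK.
  by case: (_ < _)%N; ring.
have [[m mid]|nomid] := pselect (exists m : 'I_n.+1, m = rev_ord m).
  have [v hv [p vp]] := ex_flip_simplex m.
  exists v => //; exists p => c s i; rewrite -vp; apply: spinN => x j.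
  rewrite mxE (_ : (j == m) = (j == rev_ord j))//.
  apply/eqP/eqP => [->//|/(congr1 val) /= jr]; apply: val_inj => /=.
  by move: mid => /(congr1 val) /=; lia.
have [v hv] := ex_regular_gram n; exists v => //; exists 1%g => c s i.
rewrite perm1; apply: (spinN id) => x j; case: eqP => // jr.
by case: nomid; exists j.
Qed.

End RotatingSimplex.

(** * The odd map of the join *)

Section MainMap.
Variable R : realType.

(** Adding a point is a binary convex combination with ratio [w i / (w i + W)]; the first
    alternative covers total weight 0, where normalising is impossible. *)
Lemma convex_comb m (C : set 'rV[R]_m) (I : Type) (r : seq I) (w : I -> R)
    (p : I -> 'rV[R]_m) :
  @convex_set R 'rV[R]_m C -> (forall i, 0 <= w i) ->
  (forall i, 0 < w i -> C (p i)) ->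
  (\sum_(i <- r) w i = 0 /\ \sum_(i <- r) w i *: p i = 0) \/
  (0 < \sum_(i <- r) w i /\
   C ((\sum_(i <- r) w i)^-1 *: \sum_(i <- r) w i *: p i)).
Proof.
move=> convC w0 Cp; elim: r => [|i r IH]; first by left; rewrite !big_nil.
rewrite !big_cons; have [wi0|wi0] := eqVneq (w i) 0.
  by rewrite wi0 scale0r !add0r.
have {wi0}wi0 : 0 < w i by rewrite lt_neqAle eq_sym wi0 w0.
right; case: IH => [[-> ->]|[W0 CW]].
  by rewrite !addr0; split=> //; rewrite scalerA mulVf ?gt_eqF// scale1r; apply: Cp.
set W := \sum_(j <- r) w j in W0 CW *; set P := \sum_(j <- r) _ in CW *.
have WW0 : 0 < w i + W by rewrite addr_gt0.
split=> //; have t0 : 0 <= w i / (w i + W) by rewrite divr_ge0// ltW.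
have t1 : w i / (w i + W) <= 1 by rewrite ler_pdivrMr// mul1r lerDl ltW.
have := convC (p i) (W^-1 *: P) (Itv01 t0 t1); rewrite !inE => /(_ (Cp i wi0) CW).
congr (C _).
transitivity ((w i / (w i + W)) *: p i + (1 - w i / (w i + W)) *: (W^-1 *: P)) => //.
rewrite scalerDr !scalerA [w i / _]mulrC; congr (_ + _ *: _).
by field; rewrite !gt_eqF.
Qed.

Lemma conv_hull_comb m (Y : set 'rV[R]_m) (I : finType) (w : I -> R)
    (p : I -> 'rV[R]_m) :
  (forall i, 0 <= w i) -> (exists i, 0 < w i) ->
  (forall i, 0 < w i -> Y (p i)) -> \sum_i w i *: p i = 0 -> conv_hull Y 0.
Proof.
move=> w0 [i wi] Yp wp0 C [convC YC].
have [[W0 _]|[_]] := convex_comb (index_enum I) convC w0 (fun i wi => YC _ (Yp i wi)).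
  move: wi; rewrite lt_neqAle => /andP[/eqP[]].
  by symmetry; apply: (psumr_eq0P (P := xpredT)) => //.
by rewrite wp0 scaler0.
Qed.

Lemma dot_sphere_le1 n (x y : 'rV[R]_n.+1) : sphere R n x -> sphere R n y ->
  -1 <= dot x y <= 1.
Proof.
move=> /sphereE x1 /sphereE y1.
have := dot_ge0 (x - y); have := dot_ge0 (x + y).
by rewrite dot_subE dotDl !dotDr x1 y1 (dotC y x); lra.
Qed.

Lemma diam_le_rn n (X : set 'rV[R]_n.+1) : X !=set0 -> X `<=` sphere R n ->
  (forall x y, X x -> X y -> - n.+1%:R^-1 <= dot x y) -> diam X <= rn R n.
Proof.
move=> [x0 Xx0] XS Xdot; rewrite rnE; apply: ge_sup.
  by exists (geod x0 x0), (x0, x0).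
move=> _ [[x y] [/= Xx Xy] <-]; rewrite /geod /=.
have xy1 := dot_sphere_le1 (XS _ Xx) (XS _ Xy).
have n1 : -1 <= - (n.+1%:R : R)^-1 <= 1.
  rewrite lerN2 invf_le1 ?ltr0n// ler1n /=.
  by rewrite (@le_trans _ _ 0)// oppr_le0 invr_ge0.
have acos_itv (t : R) : -1 <= t <= 1 -> acos t \in `[0, pi].
  by move=> t1; rewrite in_itv /= acos_ge0 ?acos_lepi.
rewrite leNgt -ltr_cos ?acos_itv// !acosK ?in_itv//= -leNgt.
exact: Xdot.
Qed.

(** Where [a z < 0] the product is zero near [z], so [g] may be discontinuous there. *)
Lemma cvg_cutoff (T : topologicalType) (V : normedModType R) (a : T -> R)
    (g : T -> V) (z : T) :
  {for z, continuous a} -> (a z < 0 \/ {for z, continuous g}) ->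
  {for z, continuous (fun t => Num.max 0 (a t) *: g t)}.
Proof.
move=> ca [az|cg].
  rewrite /prop_for /continuous_at /= (max_l (ltW az)) scale0r; apply: cvg_near_cst.
  have : \forall t \near z, a t < 0 by apply: (cvgr_lt (a z)).
  by apply: filterS => t at0; rewrite (max_l (ltW at0)) scale0r.
apply: cvgZ => //=; rewrite maxr_absE; under eq_fun do rewrite maxr_absE.
apply: cvgM; last exact: cvg_cst.
apply: cvgD; first by apply: cvgD => //; apply: cvg_cst.
by apply: cvg_norm; apply: cvgB => //; apply: cvg_cst.
Qed.

Lemma continuous_at_within_comp (T U W : topologicalType) (A : set U)
    (f : U -> W) (u : T -> U) (z : T) :
  {within A, continuous f} -> {for z, continuous u} ->
  (\forall t \near z, A (u t)) -> {for z, continuous (f \o u)}.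
Proof.
move=> /subspace_continuousP fA cu Au; apply: cvg_comp (fA _ (nbhs_singleton Au)).
by move=> B /cu uB; near=> t; apply: (near uB t) => //; near: t.
Unshelve. all: by end_near.
Qed.

Lemma lipschitz1_continuous (V W : normedModType R) (h : V -> W) :
  (forall x y, `|h x - h y| <= `|x - y|) -> continuous h.
Proof.
move=> h1 x; apply/cvgrPdist_lt => e e0; near=> y.
by apply: le_lt_trans (h1 x y) _; near: y; apply: cvgr_dist_lt.
Unshelve. all: by end_near.
Qed.

Lemma continuous_lsubmx n1 n2 : continuous (@lsubmx R 1 n1 n2).
Proof.
apply: lipschitz1_continuous => x y; apply: norm_le_coord => // i.
by have := coord_le_norm (x - y) (lshift n2 i); rewrite !mxE.
Qed.

Lemma continuous_rsubmx n1 n2 : continuous (@rsubmx R 1 n1 n2).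
Proof.
apply: lipschitz1_continuous => x y; apply: norm_le_coord => // i.
by have := coord_le_norm (x - y) (rshift n1 i); rewrite !mxE.
Qed.

Lemma continuous_sum (T : topologicalType) (V : normedModType R) (I : finType)
    (g : I -> T -> V) (z : T) :
  (forall i, {for z, continuous (g i)}) ->
  {for z, continuous (fun t => \sum_i g i t)}.
Proof.
by move=> cg; apply: cvg_big => [|i _]; [exact: add_continuous|exact: cg].
Qed.

Lemma continuous_dot (T : topologicalType) n (g h : T -> 'rV[R]_n) (z : T) :
  {for z, continuous g} -> {for z, continuous h} ->
  {for z, continuous (fun t => dot (g t) (h t))}.
Proof.
move=> cg ch; apply: (@continuous_sum _ R^o) => i; apply: cvgM.
  exact: (continuous_comp cg (@coord_continuous R 1 n 0 i (g z))).
exact: (continuous_comp ch (@coord_continuous R 1 n 0 i (h z))).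
Qed.

Lemma continuous_enorm (T : topologicalType) n (g : T -> 'rV[R]_n) (z : T) :
  {for z, continuous g} -> {for z, continuous (fun t => enorm (g t))}.
Proof.
move=> cg; exact: (continuous_comp (continuous_dot cg cg) (@sqrt_continuous R _)).
Qed.

Lemma continuous_spin (T : topologicalType) n (c s : T -> R) (x : 'rV[R]_n) z :
  {for z, continuous c} -> {for z, continuous s} ->
  {for z, continuous (fun t => spin (c t) (s t) x)}.
Proof.
move=> cc cs.
have spinE a b : spin a b x = spin 0 0 x + a *: (spin 1 0 x - spin 0 0 x)
                              + b *: (spin 0 1 x - spin 0 0 x).
  by apply/rowP => j; rewrite !mxE; case: eqP => _; ring.
rewrite /prop_for /continuous_at spinE; under eq_fun do rewrite spinE.
apply: cvgD; last by apply: cvgZ => //; apply: cvg_cst.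
by apply: cvgD; [exact: cvg_cst|apply: cvgZ => //; apply: cvg_cst].
Qed.

End MainMap.

(** * Weights and support points on R^2 x R^(n+1) *)

Section ZeroMap.
Variables (R : realType) (n : nat) (v : 'I_n.+2 -> 'rV[R]_n.+1).
Hypothesis v_gram : regular_gram v.
Implicit Types (z : 'rV[R]_(2 + n.+1)) (i : option 'I_n.+2).

Let Y z : 'rV[R]_2 := lsubmx z.
Let X z : 'rV[R]_n.+1 := rsubmx z.

(** Where [Y z = 0] both quotients are 0 and the result may leave the sphere; the vertices have no
    weight there. *)
Definition spun z (k : 'I_n.+2) : 'rV[R]_n.+1 :=
  spin (Y z 0 0 / enorm (Y z)) (Y z 0 1 / enorm (Y z)) (v k).

Definition support_point z i : 'rV[R]_n.+1 :=
  if i is Some k then spun z k else (enorm (X z))^-1 *: X z.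

(** The factor 1/2 makes the two ranges overlap, so some amplitude is positive whenever [z != 0]. *)
Definition amplitude z i : R :=
  if i is Some _ then enorm (Y z) - enorm (X z) / 2 else enorm (X z) - enorm (Y z).

Definition proximity z i : R :=
  if i is Some k then Num.max 0 (dot (X z) (spun z k) + enorm (Y z) / n.+1%:R)
  else 1.

Definition weight z i : R := Num.max 0 (amplitude z i) * proximity z i.

Lemma proximity_ge0 z i : 0 <= proximity z i.
Proof. by case: i => [k|] //=; rewrite le_max lexx. Qed.

Lemma weight_ge0 z i : 0 <= weight z i.
Proof. by rewrite mulr_ge0 ?proximity_ge0// le_max lexx. Qed.

Lemma weight_gt0 z i : (0 < weight z i) = (0 < amplitude z i) && (0 < proximity z i).
Proof.
rewrite /weight; have [a0|a0] := ltP 0 (amplitude z i); last by rewrite mul0r ltxx.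
by rewrite pmulr_rgt0.
Qed.

Lemma X_or_Y_neq0 z : z != 0 -> (X z != 0) || (Y z != 0).
Proof.
apply: contra_neqT; rewrite negb_or !negbK => /andP[/eqP x0 /eqP y0].
by rewrite -(hsubmxK z) -/(X z) -/(Y z) x0 y0 row_mx0.
Qed.

Lemma dot_spun z k l : Y z != 0 -> dot (spun z k) (spun z l) = dot (v k) (v l).
Proof.
move=> y0; apply: dot_spin.
have scaleE j : ((enorm (Y z))^-1 *: Y z) 0 j = Y z 0 j / enorm (Y z).
  by rewrite mxE mulrC.
have := @sphere_normalize R 1 (Y z) y0 => /sphereE.
rewrite /dot !big_ord_recl big_ord0 addr0.
have -> : lift ord0 ord0 = 1 :> 'I_2 by exact: val_inj.
by rewrite !scaleE.
Qed.

Lemma regular_spun z : Y z != 0 -> regular_gram (spun z).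
Proof. by move=> y0 i j; rewrite dot_spun. Qed.

Lemma amplitude_gt0 z i : z != 0 -> 0 < amplitude z i ->
  if i is Some _ then Y z != 0 else X z != 0.
Proof.
move=> z0; case: i => [k|] /=; rewrite -enorm_gt0.
  by have := enorm_ge0 (X z); lra.
by have := enorm_ge0 (Y z); lra.
Qed.

Lemma support_point_sphere z i : z != 0 -> 0 < weight z i -> sphere R n (support_point z i).
Proof.
move=> z0; rewrite weight_gt0 => /andP[/(amplitude_gt0 z0) + _].
case: i => [k|] /= u0; last exact: sphere_normalize.
by apply/sphereE; rewrite regular_spun// eqxx.
Qed.

Lemma weight_dot z i j : z != 0 -> 0 < weight z i -> 0 < weight z j ->
  - n.+1%:R^-1 <= dot (support_point z i) (support_point z j).
Proof.
have nV : 0 <= (n.+1%:R : R)^-1 by rewrite invr_ge0.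
(* By symmetry, the normalised [X z] comes second when paired with a vertex. *)
move=> z0; wlog : i j / (i != None) || (j == None) => [hw|ij] wi wj.
  have [ij|] := boolP ((i != None) || (j == None)); first exact: hw.
  rewrite negb_or negbK => /andP[/eqP i0 j0]; rewrite dotC; apply: hw => //.
  by rewrite j0.
have n1 : - n.+1%:R^-1 <= 1 :> R by rewrite (le_trans _ ler01)// oppr_le0.
case: i ij wi => [k _|/eqP ->] wi; last first.
  by have /sphereE -> := support_point_sphere z0 wi.
move: wi; rewrite weight_gt0 => /andP[ak pk].
have y0 : Y z != 0 := amplitude_gt0 z0 ak.
case: j wj => [l|] wj; first by rewrite regular_spun//; case: eqP.
move: wj; rewrite weight_gt0 => /andP[aN _].
have x0 : X z != 0 := amplitude_gt0 z0 aN.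
rewrite /= dotC dotZl mulrC ler_pdivlMr ?enorm_gt0//.
move: pk; rewrite /= lt_max ltxx /= => pk.
(* The positive amplitude of [None] means that [Y z] is shorter than [X z]. *)
have : enorm (Y z) / n.+1%:R <= enorm (X z) / n.+1%:R.
  by rewrite ler_wpM2r// ltW// -subr_gt0.
rewrite mulNr lerNl [leRHS]mulrC; apply: le_trans.
by rewrite -subr_ge0 opprK addrC ltW.
Qed.

(** If [None] has no weight, all vertices have positive amplitude; as they sum to 0, one has
    nonnegative inner product with [X z], hence positive proximity. *)
Lemma weight_exists z : z != 0 -> exists i, 0 < weight z i.
Proof.
move=> z0; have [a0|a0] := ltP 0 (amplitude z None).
  by exists None; rewrite weight_gt0 a0 /= ltr01.
have y0 : 0 < enorm (Y z).
  have := X_or_Y_neq0 z0; rewrite -!enorm_gt0 => /orP[|//].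
  by move: a0 => /=; lra.
have yn : 0 < enorm (Y z) / n.+1%:R by rewrite divr_gt0// ltr0n.
have [k xk] : exists k, 0 <= dot (X z) (spun z k).
  apply: contrapT => /forallNP xneg.
  have : \sum_k dot (X z) (spun z k) = 0.
    by rewrite -dot_sumr sum_regular_gram ?dotr0//; apply: regular_spun; rewrite -enorm_gt0.
  have : \sum_k dot (X z) (spun z k) < 0.
    rewrite big_ord_recl ltr_wnDr//; last by rewrite ltNge; apply/negP/xneg.
    by apply: sumr_le0 => k _; apply/ltW; rewrite ltNge; apply/negP/xneg.
  by move=> /[swap] ->; rewrite ltxx.
exists (Some k); rewrite weight_gt0; apply/andP; split; rewrite /=.
  by move: a0 => /=; lra.
by rewrite lt_max ltr_wpDl ?orbT.
Qed.

Lemma X_opp z : X (- z) = - X z. Proof. by apply/rowP => i; rewrite !mxE. Qed.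
Lemma Y_opp z : Y (- z) = - Y z. Proof. by apply/rowP => i; rewrite !mxE. Qed.

Section Odd.
Variable p : {perm 'I_n.+2}.
Hypothesis vp : forall c s k, spin (- c) (- s) (v k) = - spin c s (v (p k)).

Lemma spun_opp z k : spun (- z) k = - spun z (p k).
Proof. by rewrite /spun Y_opp enormN -vp !mxE !mulNr. Qed.

Lemma support_point_opp z i : support_point (- z) i = - support_point z (omap p i).
Proof. by case: i => [k|] /=; rewrite ?spun_opp// X_opp enormN scalerN. Qed.

Lemma weight_opp z i : weight (- z) i = weight z (omap p i).
Proof.
by case: i => [k|]; rewrite /weight /= ?spun_opp !X_opp ?Y_opp !enormN ?dotNl ?dotNr ?opprK.
Qed.

Lemma sum_weight_opp (f : 'rV[R]_n.+1 -> 'rV[R]_n.+2) z :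
  (forall x, sphere R n x -> f (- x) = - f x) -> z != 0 ->
  \sum_i weight (- z) i *: f (support_point (- z) i) = - \sum_i weight z i *: f (support_point z i).
Proof.
move=> fodd z0; rewrite -sumrN.
have omap_inj : injective (omap p) by move=> [k|] [l|] //= [/perm_inj ->].
rewrite [RHS](reindex_inj omap_inj); apply: eq_bigr => i _.
rewrite weight_opp support_point_opp -scalerN; set j := omap p i.
(* Oddness of [f] holds on the sphere only; support points off it have weight 0. *)
have [wj|] := ltP 0 (weight z j); first by rewrite fodd//; apply: support_point_sphere.
move=> wj; rewrite (_ : weight z j = 0) ?scale0r//.
by apply/eqP; rewrite eq_le wj weight_ge0.
Qed.
End Odd.

(** A support point can be discontinuous only where [Y z = 0], respectively [X z = 0]; there its
    amplitude is negative, because [z != 0]. *)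
Lemma continuous_weighted_point (f : 'rV[R]_n.+1 -> 'rV[R]_n.+2) z i :
  {within sphere R n, continuous f} -> z != 0 ->
  {for z, continuous (fun z => weight z i *: f (support_point z i))}.
Proof.
move=> fcont z0.
have cX : {for z, continuous X} by exact: continuous_rsubmx.
have cY : {for z, continuous Y} by exact: continuous_lsubmx.
have ceX := continuous_enorm cX; have ceY := continuous_enorm cY.
have neq0_near m (U : 'rV[R]_(2 + n.+1) -> 'rV[R]_m) : {for z, continuous U} ->
    U z != 0 -> \forall t \near z, U t != 0.
  move=> cU; rewrite -enorm_gt0 => U0.
  have : \forall t \near z, 0 < enorm (U t).
    by have /cvgr_gt := continuous_enorm cU; apply.
  by apply: filterS => t; rewrite enorm_gt0.
have -> : (fun t => weight t i *: f (support_point t i)) =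
    (fun t => Num.max 0 (amplitude t i) *: (proximity t i *: f (support_point t i))).
  by apply/funext => t; rewrite scalerA.
apply: cvg_cutoff.
  case: i => [k|]; last exact: (cvgB ceX ceY).
  exact: (cvgB ceY (cvgM ceX (cvg_cst (2^-1 : R)))).
have := X_or_Y_neq0 z0; case: i => [k|] /=.
  have [y0 _|y0] := eqVneq (Y z) 0; last first.
    right; have cspun : {for z, continuous (spun^~ k)}.
      have cy j : {for z, continuous (fun t => Y t 0 j / enorm (Y t))}.
        have cyj := continuous_comp cY (@coord_continuous R 1 2 0 j (Y z)).
        have eY0 : enorm (Y z) != 0 by rewrite gt_eqF ?enorm_gt0.
        exact: (cvgM cyj (cvgV eY0 ceY)).
      exact: continuous_spin.
    (* The proximity is a second cut-off coefficient. *)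
    apply: cvg_cutoff.
      exact: (cvgD (continuous_dot cX cspun) (cvgM ceY (cvg_cst (n.+1%:R^-1 : R)))).
    right; apply: (continuous_at_within_comp fcont cspun).
    apply: filterS (neq0_near _ _ cY y0) => t yt.
    by apply/sphereE; rewrite regular_spun// eqxx.
  left; have := X_or_Y_neq0 z0; rewrite y0 eqxx orbF -enorm_gt0 enorm0.
  by lra.
have [x0 /= y0|x0 _] := eqVneq (X z) 0.
  by left; rewrite x0 enorm0 sub0r oppr_lt0 enorm_gt0.
right; rewrite [X in {for _, continuous X}](_ : _ = f \o support_point^~ None); last first.
  by apply/funext => t; rewrite scale1r.
apply: (continuous_at_within_comp fcont).
  have eX0 : enorm (X z) != 0 by rewrite gt_eqF ?enorm_gt0.
  exact: (cvgZ (cvgV eX0 ceX) cX).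
apply: filterS (neq0_near _ _ cX x0) => t xt; exact: sphere_normalize.
Qed.

Lemma continuous_weighted_sum (f : 'rV[R]_n.+1 -> 'rV[R]_n.+2) z :
  {within sphere R n, continuous f} -> z != 0 ->
  {for z, continuous (fun z => \sum_i weight z i *: f (support_point z i))}.
Proof.
by move=> fcont z0; apply: continuous_sum => i; apply: continuous_weighted_point.
Qed.

End ZeroMap.

Theorem theorem3 (R : realType) (n : nat) (hn : (1 <= n)%N)
    (f : 'rV[R]_n.+1 -> 'rV[R]_n.+2)
    (f_odd : forall x, sphere R n x -> f (- x) = - f x)
    (f_cont : {within sphere R n, continuous f}) :
  exists X : set 'rV[R]_n.+1,
    [/\ X `<=` sphere R n, diam X <= rn R n & conv_hull (f @` X) 0].
Proof.
have [v hv [p vp]] := ex_spinning_simplex R n.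
(* The domain dimension [2 + n.+1] is [n.+3], one more than that of the target. *)
have [||z z0 Fz] := @borsuk_ulam R n.+2
    (fun z => \sum_i weight v z i *: f (support_point v z i)).
- by move=> z; apply: continuous_weighted_sum.
- by move=> z z0; exact: (sum_weight_opp hv vp f_odd z0).
exists (support_point v z @` [set i | 0 < weight v z i]).
have [i0 wi0] := weight_exists hv z0.
have Xsphere : support_point v z @` [set i | 0 < weight v z i] `<=` sphere R n.
  by move=> _ [i wi <-]; apply: support_point_sphere.
split=> //.
  apply: diam_le_rn => //; first by exists (support_point v z i0), i0.
  by move=> _ _ [i wi <-] [j wj <-]; apply: weight_dot.
apply: (conv_hull_comb (weight_ge0 v z) _ _ Fz); first by exists i0.
by move=> i wi; exists (support_point v z i) => //; exists i.
Qed.
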